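(* Let $\alpha > 0$ and $\lambda > 0$, let $n \geq 2$ be an integer, and let $Y_1,\ldots,Y_n$ be independent and identically distributed random variables, each following the gamma distribution with shape parameter $\alpha$ and rate parameter $\lambda$, i.e., with density $$f(y) = \frac{\lambda^\alpha}{\Gamma(\alpha)}\, y^{\alpha-1} e^{-\lambda y}, \quad y > 0.$$ Let $\mathrm{VMR}_n$ denote the sample variance-to-mean ratio $$\mathrm{VMR}_n = \frac{1}{n-1}\, \frac{\sum_{i=1}^n (Y_i - \mu_n)^2}{\mu_n}, \qquad \mu_n = \frac{1}{n}\sum_{i=1}^n Y_i.$$ Then $$\mathrm{E}(\mathrm{VMR}_n) = \frac{n\alpha}{(n\alpha+1)\lambda}.$$
   Context: Here $\Gamma(\cdot)$ is the gamma function and $\mathrm{E}$ denotes expectation. The sample variance-to-mean ratio $\mathrm{VMR}_n$ is defined for $n \geq 2$, and $\mu_n$ is the sample mean. *)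

(* Defs.v *)
(* MathComp / MathComp-Analysis *)
From HB Require Import structures.
From mathcomp Require Import all_boot all_order all_algebra.
From mathcomp Require Import all_classical all_reals all_analysis.

Set Implicit Arguments.
Unset Strict Implicit.
Unset Printing Implicit Defensive.

Import Order.TTheory GRing.Theory Num.Theory.
Import numFieldNormedType.Exports.

Local Open Scope classical_set_scope.
Local Open Scope ring_scope.

(* Real-valued integral: for a > 0 it converges, and for a <= 0 it diverges,
   in which case the value is the junk value 0. *)
Definition gamma_fun {R : realType} (a : R) : R :=
  \int[lebesgue_measure]_(x in `]0, +oo[) (x `^ (a - 1) * expR (- x)).

(* The parameters are the shape [alpha] and the rate (not scale) [lambda]. *)
Definition gamma_pdf {R : realType} (alpha lambda : R) : R -> R :=
  (fun y => lambda `^ alpha / gamma_fun alpha * y `^ (alpha - 1)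
            * expR (- lambda * y)) \_ `]0, +oo[.

Definition gamma_prob {R : realType} (alpha lambda : R) (A : set R) : \bar R :=
  (\int[lebesgue_measure]_(y in A) (gamma_pdf alpha lambda y)%:E)%E.

(* Mutual independence: the product rule for every subfamily [J], not just
   for pairs. *)
Definition independent_RVs d d' (T : measurableType d) (T' : measurableType d')
    (R : realType) (P : probability T R) (I : finType)
    (X : I -> {RV P >-> T'}) : Prop :=
  forall (J : {set I}) (A : I -> set T'),
    (forall i, i \in J -> measurable (A i)) ->
    P (\bigcap_(i in [set` J]) (X i @^-1` A i)) =
    (\prod_(i in J) P (X i @^-1` A i))%E.

Definition sample_mean {R : realType} (n : nat) (y : 'I_n -> R) : R :=
  n%:R^-1 * \sum_(i < n) y i.

(* Sample variance with the n - 1 normalization, divided by the sample mean;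
   it is 0 by convention where the sample mean vanishes. *)
Definition sample_VMR {R : realType} (n : nat) (y : 'I_n -> R) : R :=
  (n%:R - 1)^-1 * ((\sum_(i < n) (y i - sample_mean y) ^+ 2) / sample_mean y).

(* Main.v *)
Require Import Defs.
From HB Require Import structures.
From mathcomp Require Import all_boot all_order all_algebra.
From mathcomp Require Import all_classical all_reals all_analysis.
From mathcomp Require Import measurable_realfun exponential_distribution ring.

(* Expanding the square gives VMR = (n (sum Y_i^2) / S - S) / (n - 1) with
   S = sum Y_i.  Since 1 / S is the integral of exp (- t S) over t > 0, Tonelli
   and independence reduce E (Y_i^2 / S) to the integral over t of a product of
   Laplace transforms,
     alpha (alpha + 1) lambda^(n alpha) (lambda + t)^(- n alpha - 2),
   which is elementary.  The recurrence Gamma (a + 1) = a Gamma (a) is obtained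
   in the same way: both orders of integration of y^a exp (- (1 + t) y) over
   t, y > 0 are explicit, so no integration by parts at 0 is needed. *)

Set Implicit Arguments.
Unset Strict Implicit.
Unset Printing Implicit Defensive.

Import Order.TTheory GRing.Theory Num.Theory.
Import numFieldNormedType.Exports.

Local Open Scope classical_set_scope.
Local Open Scope ring_scope.

Import HBNNSimple.

(** * Integration against weighted image measures *)

(** Agreement on indicators extends to simple functions by linearity and to [f] by monotone
    convergence. The weight [w] will be a constant, a product of the remaining independent factors,
    or a density. *)
Lemma ge0_integral_weighted d d' (T : measurableType d) (T' : measurableType d')
    (R : realType) (mu : {measure set T -> \bar R})
    (nu : {measure set T' -> \bar R}) (X : T -> T') (w : T -> R) :
  measurable_fun setT X -> measurable_fun setT w -> (forall x, 0 <= w x) ->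
  (forall A, measurable A -> (\int[mu]_x (w x * \1_A (X x))%:E)%E = nu A) ->
  forall f : T' -> R, measurable_fun setT f -> (forall y, 0 <= f y) ->
  (\int[mu]_x (w x * f (X x))%:E = \int[nu]_y (f y)%:E)%E.
Proof.
move=> mX mw w0 muwE f mf f0.
have mf' : measurable_fun setT (fun y => (f y)%:E) by exact/measurable_EFinP.
pose h := nnsfun_approx measurableT mf'.
have hf y : EFin (h n y) @[n --> \oo] --> (f y)%:E.
  by apply: (cvg_nnsfun_approx measurableT mf') => // z _; rewrite lee_fin.
have h_nd y : nondecreasing_seq (h ^~ y).
  by move=> m n mn; exact/lefP/nd_nnsfun_approx.
have mwg (g : T' -> R) : measurable_fun setT g ->
    measurable_fun setT (fun x => (w x * g (X x))%:E).
  by move=> mg; apply/measurable_EFinP/measurable_funM => //;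
    exact: measurableT_comp.
transitivity (limn (fun n => \int[mu]_x (w x * h n (X x))%:E)%E).
  rewrite -monotone_convergence//.
  - apply: eq_integral => x _; apply/esym/cvg_lim => //.
    under eq_fun do rewrite EFinM.
    by rewrite EFinM; apply: cvgeZl => //; exact: hf.
  - by move=> n; exact: mwg.
  - by move=> n x _; rewrite lee_fin mulr_ge0.
  - by move=> x _ m n mn; rewrite lee_fin ler_wpM2l//; exact: h_nd.
transitivity (limn (fun n => \int[nu]_y (h n y)%:E)%E); last first.
  rewrite -monotone_convergence//.
  - by apply: eq_integral => y _; apply/cvg_lim => //; exact: hf.
  - by move=> n; exact/measurable_EFinP.
  - by move=> n y _; rewrite lee_fin.
  - by move=> y _ m n mn; rewrite lee_fin; exact: h_nd.
congr (limn _); apply/funext => n.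
under eq_integral do rewrite fimfunE mulr_fsumr// -fsumEFin//.
under [RHS]eq_integral do rewrite fimfunE -fsumEFin//.
have range_ge0 r : r \in range (h n) -> 0 <= r.
  by rewrite inE => -[t _ <-].
rewrite ge0_integral_fsum//; last 2 first.
- by move=> r; apply: (mwg (fun y => r * \1_(h n @^-1` [set r]) y));
    exact: measurable_funM.
- by move=> r x _; rewrite EFinM mule_ge0 ?lee_fin// -lee_fin;
    exact: nnfun_muleindic_ge0.
rewrite ge0_integral_fsum//; last 2 first.
- by move=> r; apply/measurable_EFinP/measurable_funM.
- by move=> r x _; exact: nnfun_muleindic_ge0.
apply: eq_fsbigr => r rh.
under eq_integral do rewrite mulrCA EFinM.
rewrite ge0_integralZl_EFin ?range_ge0//; last 2 first.
- by move=> x _; rewrite lee_fin mulr_ge0.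
- exact: mwg.
under [RHS]eq_integral do rewrite EFinM.
rewrite ge0_integralZl_EFin ?range_ge0//; last first.
- exact/measurable_EFinP.
by rewrite muwE// integral_indic// setIT.
Qed.

(** The pushforward of Lebesgue measure under [x -> b x], multiplied by [b], gives half-open
    intervals their length, hence is Lebesgue measure by uniqueness. *)
Lemma integral_scaling (R : realType) (b : R) (f : R -> R) : 0 < b ->
  measurable_fun setT f -> (forall x, 0 <= f x) ->
  (\int[lebesgue_measure]_x (f (b * x))%:E =
   (b^-1)%:E * \int[lebesgue_measure]_x (f x)%:E)%E.
Proof.
move=> b0 mf f0.
have mb : measurable_fun [set: measurableTypeR R]
    (fun x => b * x : measurableTypeR R) by exact: measurable_funM.
have lebE (A : set R) : measurable A ->
    lebesgue_measure A = (mscale (NngNum (ltW b0))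
      (pushforward lebesgue_measure (fun x => b * x : measurableTypeR R))) A.
  move=> mA; apply: lebesgue_measure_unique => // _ [[x y] _ <-].
  rewrite /mscale/= /pushforward.
  transitivity
    (b%:E * lebesgue_measure `](x / b)%R, (y / b)%R]%classic)%E; last first.
    congr (_ * lebesgue_measure _)%E.
    apply/seteqP; split => z /=; rewrite !in_itv/=;
      by rewrite ltr_pdivrMr// ler_pdivlMr// mulrC.
  rewrite !lebesgue_measure_itv/= !lte_fin ltr_pM2r ?invr_gt0//.
  case: ifPn => xy; last by rewrite mule0.
  by rewrite -!EFinD -EFinM -mulrBl mulrC divfK// gt_eqF.
have int_scale : (\int[lebesgue_measure]_x (b * f (b * x))%:E =
    \int[lebesgue_measure]_x (f x)%:E)%E.
  apply: (@ge0_integral_weighted _ _ (measurableTypeR R) (measurableTypeR R)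
    R lebesgue_measure lebesgue_measure (fun x => b * x) (cst b)) => //.
    by move=> x; exact: ltW.
  move=> A mA; apply: (etrans _ (esym (lebE mb A mA))).
  rewrite /mscale/= /pushforward.
  under eq_integral do rewrite EFinM.
  have mbA : measurable ((fun x => b * x : measurableTypeR R) @^-1` A).
    by rewrite -[X in measurable X]setTI; exact: mb.
  rewrite ge0_integralZl_EFin ?ltW//.
    by rewrite -[in RHS](setIT ((fun x => b * x) @^-1` A)) -integral_indic.
  by apply/measurable_EFinP; exact: (measurableT_comp _ mb).
rewrite -int_scale.
under [in RHS]eq_integral do rewrite EFinM.
rewrite ge0_integralZl_EFin ?ltW//.
- by rewrite muleA -EFinM mulVf ?gt_eqF// mul1e.
- by move=> x _; rewrite lee_fin.
- by apply/measurable_EFinP; exact: (measurableT_comp _ mb).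
Qed.

(** * Product rule for independent variables *)

(** Independence concerns events, that is, indicator factors; each general factor is reached from
    indicators while the other factors are kept as a weight. *)
Lemma integral_prod_independent d d' (T : measurableType d)
    (T' : measurableType d') (R : realType) (P : probability T R)
    (I : finType) (Y : I -> {RV P >-> T'}) (g : I -> T' -> R) (c : I -> R) :
  independent_RVs Y ->
  (forall i, measurable_fun setT (g i)) -> (forall i y, 0 <= g i y) ->
  (forall i, (\int[P]_w (g i (Y i w))%:E = (c i)%:E)%E) ->
  (\int[P]_w (\prod_i g i (Y i w))%:E = (\prod_i c i)%:E)%E.
Proof.
move=> indY.
(* The indices of the non-indicator factors are put in [s] one at a time. *)
suff H (s : seq I) : forall (g : I -> T' -> R) (c : I -> R),
    (forall i, i \notin s -> exists2 A, measurable A & g i = \1_A) ->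
    (forall i, measurable_fun setT (g i)) -> (forall i y, 0 <= g i y) ->
    (forall i, (\int[P]_w (g i (Y i w))%:E = (c i)%:E)%E) ->
    (\int[P]_w (\prod_i g i (Y i w))%:E = (\prod_i c i)%:E)%E.
  by move=> mg g0 gc; apply: (H (enum I)) => // i; rewrite mem_enum.
elim: s => [|k s IH] {}g {}c gA mg g0 gc.
  (* All factors are indicators here, so their product is the indicator of an intersection, and
     independence applies with [J] the whole index set. *)
  have /all_sig2[A mA gE] : forall i, {A : set T' | measurable A & g i = \1_A}.
    by move=> i; have [|A mA ->] := cid2 (gA i _) => //; exists A.
  have cE i : (c i)%:E = P (Y i @^-1` A i).
    rewrite -gc gE.
    rewrite (_ : (fun w => _) = EFin \o \1_(Y i @^-1` A i)); last first.
      by [].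
    rewrite integral_indic// ?setIT// -[X in measurable X]setTI.
    exact: measurable_funP.
  rewrite -prodEFin.
  under [RHS]eq_bigr do rewrite cE.
  have := indY [set: I]%SET A (fun i _ => mA i).
  under [X in _ = X -> _]eq_bigl do rewrite inE.
  move=> <-.
  rewrite -[in RHS](setIT (\bigcap_(i in _) _)) -integral_indic//; last first.
    apply: fin_bigcap_measurable => // i _.
    by rewrite -[X in measurable X]setTI; exact: measurable_funPT.
  apply: eq_integral => w _; congr EFin.
  have [wA|wA] := pselect (forall i, A i (Y i w)).
    rewrite indicE mem_set//; last by move=> i _; exact: wA.
    by rewrite big1// => i _; rewrite gE indicE mem_set.
  rewrite indicE memNset//; last first.
    by move=> h; apply: wA => i; apply: h; rewrite /= inE.
  move/existsNP : wA => [i wAi].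
  by rewrite (bigD1 i)//= gE indicE memNset// mul0r.
(* The factors other than [k] form the weight [w]. By induction, integrating [w] over the event that
   [Y k] lies in [A] gives [r] times the law of [Y k] at [A]; [ge0_integral_weighted] then passes
   from [\1_A] to [g k]. *)
pose w x := \prod_(i | i != k) g i (Y i x).
pose r := \prod_(i | i != k) c i.
have c0 i : 0 <= c i.
  by rewrite -lee_fin -gc integral_ge0// => x _; rewrite lee_fin.
have r0 : 0 <= r by exact: prodr_ge0.
pose nu := mscale (NngNum r0) (distribution P (Y k)).
have mw : measurable_fun setT w.
  rewrite /w; under eq_fun do rewrite -big_filter.
  apply: measurable_prod => i _.
  exact: measurableT_comp.
have IHA A : measurable A -> (\int[P]_x (w x * \1_A (Y k x))%:E = nu A)%E.
  move=> mA.
  pose g' i := if i == k then \1_A else g i.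
  pose c' i := if i == k then fine (P (Y k @^-1` A)) else c i.
  have mYA : measurable (Y k @^-1` A).
    by rewrite -[X in measurable X]setTI; exact: measurable_funPT.
  have g'k : g' k = \1_A by rewrite /g' eqxx.
  have g'E i : i != k -> g' i = g i by rewrite /g' => /negbTE ->.
  have c'E i : i != k -> c' i = c i by rewrite /c' => /negbTE ->.
  transitivity (\int[P]_x (\prod_i g' i (Y i x))%:E)%E.
    apply: eq_integral => x _; rewrite (bigD1 k)//= g'k mulrC; congr (_ * _)%:E.
    by apply: eq_bigr => i ik; rewrite g'E.
  rewrite (IH g' c').
  - rewrite (bigD1 k)//= (eq_bigr c c'E) mulrC EFinM; congr (_ * _)%E.
    by rewrite /c' eqxx fineK// fin_num_measure.
  - move=> i iks; have [->|ik] := eqVneq i k; first by exists A.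
    by rewrite g'E//; apply: gA; rewrite inE negb_or ik.
  - move=> i; have [->|ik] := eqVneq i k; last by rewrite g'E.
    by rewrite g'k; exact: measurable_indic.
  - move=> i y; have [->|ik] := eqVneq i k; last by rewrite g'E.
    by rewrite g'k indicE.
  - move=> i; have [->|ik] := eqVneq i k; last by rewrite g'E// c'E.
    rewrite g'k /c' eqxx fineK ?fin_num_measure//.
    by rewrite -[in RHS](setIT (Y k @^-1` A)) -integral_indic.
under eq_integral do rewrite (bigD1 k)//= mulrC.
rewrite (@ge0_integral_weighted _ _ _ _ _ P nu (Y k) w)//; last first.
  by move=> x; exact: prodr_ge0.
rewrite ge0_integral_mscale//; last 2 first.
- exact/measurable_EFinP.
- by move=> y _; rewrite lee_fin.
rewrite ge0_integral_distribution; last 2 first.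
- exact/measurable_EFinP.
- by move=> y; rewrite lee_fin.
by rewrite /= gc (bigD1 k)//= mulrC.
Qed.

(** * Integrals of the unnormalised gamma density *)

(** Unnormalised gamma density of shape [a] and rate [b]. On y > 0, shape 1 gives the Laplace factor
    exp(-by), shape 3 gives y^2 exp(-by), and shape 2 with rate 0 gives y. *)
Definition gamma_kernel {R : realType} (a b y : R) : R :=
  \1_`]0, +oo[ y * (y `^ (a - 1) * expR (- (b * y))).

Lemma measurable_indic_pos (R : realType) d (T : measurableType d)
    (v : T -> R) :
  measurable_fun setT v ->
  measurable_fun setT (fun x => \1_`]0, +oo[ (v x) : R).
Proof.
move=> mv.
have m1 : measurable_fun [set: R] (\1_`]0, +oo[ : R -> R).
  exact: measurable_indic.
exact: (measurableT_comp m1).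
Qed.

Lemma gt0_powRD (R : realType) (x r s : R) : 0 < x ->
  x `^ (r + s) = x `^ r * x `^ s.
Proof. by move=> x0; rewrite powRD// (gt_eqF x0) implybT. Qed.

Section gamma_kernel.
Context {R : realType}.
Implicit Types a b y : R.

Lemma gamma_kernelE a b y : 0 < y ->
  gamma_kernel a b y = y `^ (a - 1) * expR (- (b * y)).
Proof.
move=> y0; rewrite /gamma_kernel indicE mem_set ?mul1r//=.
by rewrite in_itv/= y0.
Qed.

Lemma gamma_kernel_le0 a b y : y <= 0 -> gamma_kernel a b y = 0.
Proof.
move=> y0; rewrite /gamma_kernel indicE memNset ?mul0r//=.
by rewrite in_itv/= andbT; apply/negP; rewrite -leNgt.
Qed.

Lemma gamma_kernel_ge0 a b y : 0 <= gamma_kernel a b y.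
Proof. by rewrite !mulr_ge0 ?powR_ge0 ?expR_ge0. Qed.

Lemma measurable_gamma_kernel2 d (T : measurableType d) a (u v : T -> R) :
  measurable_fun setT u -> measurable_fun setT v ->
  measurable_fun setT (fun x => gamma_kernel a (u x) (v x)).
Proof.
move=> mu mv; apply: measurable_funM.
  exact: measurable_indic_pos.
apply: measurable_funM.
  exact: (measurableT_comp (measurable_powR _) mv).
have muv : measurable_fun setT (fun x => - (u x * v x)).
  by apply: measurableT_comp => //; exact: measurable_funM.
exact: (measurableT_comp (@measurable_expR R) muv).
Qed.

Lemma measurable_gamma_kernel a b : measurable_fun setT (gamma_kernel a b).
Proof. exact: measurable_gamma_kernel2. Qed.

Lemma gamma_kernelM a1 b1 a2 b2 y :
  gamma_kernel a1 b1 y * gamma_kernel a2 b2 y =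
  gamma_kernel (a1 + a2 - 1) (b1 + b2) y.
Proof.
have [y0|y0] := leP y 0; first by rewrite !gamma_kernel_le0// mul0r.
rewrite !gamma_kernelE// mulrACA -gt0_powRD//.
by rewrite -expRD -opprD -mulrDl; congr (_ `^ _ * _); rewrite addrAC !addrA.
Qed.

Lemma gamma_kernel_scaling a b y : 0 < b ->
  gamma_kernel a b y = b `^ (1 - a) * gamma_kernel a 1 (b * y).
Proof.
move=> b0; have [y0|y0] := leP y 0.
  by rewrite !gamma_kernel_le0 ?mulr0// pmulr_rle0.
rewrite !gamma_kernelE// ?mulr_gt0// mul1r powRM ?ltW// !mulrA -gt0_powRD//.
by rewrite addrA subrK subrr powRr0 mul1r.
Qed.

(** The equality is in the extended reals, so that it applies before convergence is known, as to the
    integral [G] in the recurrence below. *)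
Lemma integral_gamma_kernel_scaling a b : 0 < b ->
  (\int[lebesgue_measure]_y (gamma_kernel a b y)%:E =
   (b `^ (- a))%:E * \int[lebesgue_measure]_y (gamma_kernel a 1 y)%:E)%E.
Proof.
move=> b0.
under eq_integral do rewrite gamma_kernel_scaling// EFinM.
rewrite ge0_integralZl_EFin ?powR_ge0//; last 2 first.
- by move=> y _; rewrite lee_fin gamma_kernel_ge0.
- have mb : measurable_fun [set: R] (fun y => b * y).
    exact: measurable_funM.
  apply/measurable_EFinP.
  exact: (measurable_gamma_kernel2 _ (measurable_cst _) mb).
rewrite (@integral_scaling _ _ (gamma_kernel a 1))//; last 2 first.
- exact: measurable_gamma_kernel.
- by move=> y; exact: gamma_kernel_ge0.
rewrite muleA -EFinM -[b^-1]powR_inv1 ?ltW// -gt0_powRD//.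
by rewrite addrAC subrr add0r.
Qed.

Lemma integral_gamma_kernel1 b : 0 < b ->
  (\int[lebesgue_measure]_y (gamma_kernel 1 b y)%:E = (b^-1)%:E)%E.
Proof.
move=> b0; rewrite integral_gamma_kernel_scaling// powR_inv1 ?ltW//.
rewrite [X in (_ * X)%E](_ : _ = 1%E) ?mule1//.
rewrite -(integral_exponential_pdf (ltr01 : 0 < 1 :> R)).
apply: ae_eq_integral => //.
- by apply/measurable_EFinP; exact: measurable_gamma_kernel.
- by apply/measurable_EFinP; exact: measurable_exponential_pdf.
(* The kernel and the exponential density differ only at 0, where they are 0 and 1. *)
exists [set 0]; split => //; first exact: lebesgue_measure_set1.
move=> y /= /not_implyP[_]; apply: contra_notP => /eqP y0; congr EFin.
have [yneg|ypos|ye] := ltgtP y 0; last by rewrite ye eqxx in y0.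
  by rewrite gamma_kernel_le0 ?ltW// lt0_exponential_pdf.
rewrite gamma_kernelE// exponential_pdfE ?ltW//.
by rewrite subrr powRr0 mulNr.
Qed.

(** Both uses of Tonelli end in this integral, with [b = 1] for the recurrence of Gamma and
    [b = lambda] for the ratio. [F] is an antiderivative of [f] that vanishes at infinity. *)
Lemma integral_shifted_power a b : 0 < a -> 0 < b ->
  (\int[lebesgue_measure]_t (\1_`]0, +oo[ t * (b + t) `^ (- a - 1))%:E =
   (b `^ (- a) / a)%:E)%E.
Proof.
move=> a0 b0.
pose f t : R := (b + t) `^ (- a - 1).
pose F t : R := - (a^-1 * (b + t) `^ (- a)).
have dadd (t : R) : is_derive t 1 (fun t : R => b + t) 1.
  have := is_deriveD (is_derive_cst b t 1) (is_derive_id t 1).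
  by rewrite add0r.
have dpowr c (t : R) : 0 <= t ->
    is_derive t 1 (fun t => (b + t) `^ c) (c * (b + t) `^ (c - 1) * 1).
  move=> t0; have bt : 0 < b + t by rewrite ltr_wpDr.
  exact: (@is_derive1_comp _ (fun x => x `^ c) (fun t : R => b + t) t _ _
    (is_derive1_powR c bt) (dadd t)).
have dF (t : R) : 0 <= t -> is_derive t 1 F (f t).
  move=> t0.
  have d2 := is_deriveN (is_deriveZ a^-1 (dpowr (- a) _ t0)).
  apply: is_derive_eq.
  by rewrite mulr1 mulNr scalerN opprK /GRing.scale/= mulKf// gt_eqF.
have cont (g : R -> R) (t l : R) : is_derive t 1 g l -> {for t, continuous g}.
  move=> [+ _]; move/derivable1_diffP; exact: differentiable_continuous.
have cf (t : R) : 0 <= t -> {for t, continuous f}.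
  by move=> t0; exact: (cont _ _ _ (dpowr _ _ t0)).
transitivity (\int[lebesgue_measure]_(t in `[0%R, +oo[) (f t)%:E)%E.
  rewrite -integral_itv_obnd_cbnd; last first.
    apply/measurable_EFinP.
    apply: open_continuous_measurable_fun => // t.
    by rewrite inE/= in_itv/= andbT => /ltW; exact: cf.
  rewrite [RHS]integral_mkcond; apply: eq_integral => t _.
  by rewrite patchE indicE; case: ifPn => _; rewrite ?mul1r ?mul0r.
rewrite (@ge0_continuous_FTC2y _ f F 0 0).
- by rewrite /F addr0 -EFinN opprK add0e mulrC.
- by move=> t _; exact: powR_ge0.
- apply/continuous_within_itvcyP; split.
    by move=> t; rewrite in_itv/= andbT => /ltW; exact: cf.
  by apply: cvg_at_right_filter; exact: cf.
(* Limit of [F]: (b+t)^(-a) = exp(-a ln(b+t)), and ln(b+t) is at least [A] once [t] is at least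
   exp(A). *)
- rewrite -oppr0; apply: cvgN; rewrite -[X in _ --> X](mulr0 a^-1).
  apply: cvgM; first exact: cvg_cst.
  apply: (@cvg_trans _ ((expR (- (a * ln (b + t)))) @[t --> +oo])).
    apply: near_eq_cvg; near=> t; rewrite /powR gt_eqF ?mulNr//.
    by rewrite addr_gt0//; near: t; exact: nbhs_pinfty_gt.
  apply: (@cvg_comp _ _ _ (fun t => a * ln (b + t)) (fun x => expR (- x)) _
    (pinfty_nbhs R)); last exact: cvgr_expR.
  apply: gt0_cvgMry => //; apply/cvgryPge => A; near=> t.
  have eAt : expR A <= b + t.
    apply: (@le_trans _ _ t); last by rewrite lerDr ltW.
    by near: t; apply: nbhs_pinfty_ge; exact: num_real.
  rewrite -[A]expRK ler_ln ?posrE ?expR_gt0//.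
  exact: lt_le_trans (expR_gt0 _) eAt.
- by move=> t /ltW t0; have [] := dF t t0.
- by apply: cvg_at_right_filter; apply: (cont F); exact: dF.
- move=> t; rewrite in_itv/= andbT => /ltW t0.
  by rewrite derive1E; have [_ ->] := dF t t0.
Unshelve. all: end_near.
Qed.

(** Only Gamma(a) is assumed finite; equating the two iterated integrals in the extended reals also
    proves convergence at [a + 1]. *)
Lemma integral_gamma_kernelS a g : 0 < a ->
  (\int[lebesgue_measure]_y (gamma_kernel a 1 y)%:E = g%:E)%E ->
  (\int[lebesgue_measure]_y (gamma_kernel (a + 1) 1 y)%:E = (a * g)%:E)%E.
Proof.
move=> a0 Gg.
pose f (z : R * R) : \bar R :=
  (\1_`]0, +oo[ z.1 * gamma_kernel (a + 1) (1 + z.1) z.2)%:E.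
have mf : measurable_fun setT f.
  apply/measurable_EFinP/measurable_funM.
    exact: measurable_indic_pos.
  apply: measurable_gamma_kernel2 => //.
  exact: measurable_funD.
have f0 z : (0 <= f z)%E.
  by rewrite lee_fin mulr_ge0// gamma_kernel_ge0.
have := fubini_tonelli (m1 := lebesgue_measure) (m2 := lebesgue_measure)
  f mf f0.
pose G := (\int[@lebesgue_measure R]_y (gamma_kernel (a + 1) 1 y)%:E)%E.
have G0 : (0 <= G)%E.
  by apply: integral_ge0 => y _; rewrite lee_fin gamma_kernel_ge0.
(* With [y] integrated first, scaling by 1+t leaves (1+t)^(-a-1) times [G]. *)
rewrite [LHS](_ : _ = (a^-1)%:E * G)%E; last first.
  transitivity (\int[lebesgue_measure]_t
    ((\1_`]0, +oo[ t * (1 + t) `^ (- a - 1))%:E * G))%E.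
    apply: eq_integral => t _; rewrite /f/=.
    under eq_integral do rewrite EFinM.
    rewrite ge0_integralZl_EFin//; last 2 first.
    - by move=> y _; rewrite lee_fin gamma_kernel_ge0.
    - by apply/measurable_EFinP; exact: measurable_gamma_kernel.
    have [t0|t0] := leP t 0.
      rewrite indicE memNset ?mul0r ?mul0e//=.
      by rewrite in_itv/= andbT; apply/negP; rewrite -leNgt.
    rewrite EFinM -muleA integral_gamma_kernel_scaling ?addr_gt0//.
    by rewrite opprD.
  rewrite ge0_integralZr//; last 2 first.
  - have m1 : measurable_fun [set: R] (fun t => 1 + t).
      exact: measurable_funD.
    apply/measurable_EFinP/measurable_funM; first exact: measurable_indic_pos.
    exact: (measurableT_comp (measurable_powR _) m1).
  - by move=> t _; rewrite lee_fin mulr_ge0// powR_ge0.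
  by rewrite integral_shifted_power// powR1 mul1r.
(* With [t] integrated first, a factor 1/y appears and lowers the shape from a+1 to a. *)
rewrite [RHS](_ : _ = g%:E) => [aG|].
  by rewrite EFinM -aG muleA -EFinM mulfV ?gt_eqF// mul1e.
rewrite -Gg; apply: eq_integral => y _; rewrite /f/=.
have [y0|y0] := leP y 0.
  rewrite [in RHS]gamma_kernel_le0//; apply: integral0_eq => t _.
  by rewrite gamma_kernel_le0// mulr0.
transitivity (\int[lebesgue_measure]_t
  ((gamma_kernel (a + 1) 1 y)%:E * (gamma_kernel 1 y t)%:E))%E.
  apply: eq_integral => t _; rewrite -EFinM; congr EFin.
  rewrite !(gamma_kernelE _ _ y0) /gamma_kernel subrr powRr0 mul1r.
  have -> : (1 + t) * y = 1 * y + y * t by ring.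
  by rewrite opprD expRD !mul1r; ring.
rewrite ge0_integralZl_EFin ?gamma_kernel_ge0//; last 2 first.
- by move=> t _; rewrite lee_fin gamma_kernel_ge0.
- by apply/measurable_EFinP; exact: measurable_gamma_kernel.
rewrite integral_gamma_kernel1// -EFinM; congr EFin.
rewrite !gamma_kernelE// addrK mulrAC; congr (_ * _).
by rewrite -[y^-1]powR_inv1 ?ltW// -gt0_powRD.
Qed.

End gamma_kernel.

(** * Gamma function and gamma density in terms of the kernel *)

Lemma gamma_funE (R : realType) (a : R) :
  gamma_fun a = fine (\int[lebesgue_measure]_y (gamma_kernel a 1 y)%:E)%E.
Proof.
rewrite /gamma_fun /Rintegral; congr fine.
rewrite integral_mkcond; apply: eq_integral => y _.
rewrite patchE /gamma_kernel indicE; case: ifPn => _; rewrite ?mul0r//.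
by rewrite !mul1r.
Qed.

Lemma gamma_pdfE (R : realType) (a b y : R) :
  gamma_pdf a b y = b `^ a / gamma_fun a * gamma_kernel a b y.
Proof.
rewrite /gamma_pdf patchE /gamma_kernel indicE.
by case: ifPn => _; rewrite ?mul0r ?mulr0// mul1r mulNr !mulrA.
Qed.

Lemma gamma_fun_ge0 (R : realType) (a : R) : 0 <= gamma_fun a.
Proof.
rewrite gamma_funE fine_ge0// integral_ge0// => y _.
by rewrite lee_fin gamma_kernel_ge0.
Qed.

Lemma gamma_pdf_ge0 (R : realType) (a b y : R) : 0 <= gamma_pdf a b y.
Proof.
rewrite gamma_pdfE mulr_ge0 ?gamma_kernel_ge0//.
by rewrite divr_ge0 ?powR_ge0 ?gamma_fun_ge0.
Qed.

Lemma measurable_gamma_pdf (R : realType) (a b : R) :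
  measurable_fun setT (gamma_pdf a b).
Proof.
rewrite (_ : gamma_pdf a b =
  fun y => b `^ a / gamma_fun a * gamma_kernel a b y); last first.
  by apply/funext => y; rewrite gamma_pdfE.
by apply: measurable_funM => //; exact: measurable_gamma_kernel.
Qed.

(** * Moments and Laplace transform of a gamma variable *)

Section gamma_variable.
Context {R : realType} d (T : measurableType d) (P : probability T R).
Variables (alpha lambda : R) (X : {RV P >-> R}).
Hypotheses (alpha_gt0 : 0 < alpha) (lambda_gt0 : 0 < lambda).
Hypothesis X_gamma : forall A : set R, measurable A ->
  distribution P X A = gamma_prob alpha lambda A.

Lemma integral_gamma_variable (f : R -> R) :
  measurable_fun setT f -> (forall y, 0 <= f y) ->
  (\int[P]_w (f (X w))%:E =
   \int[lebesgue_measure]_y (gamma_pdf alpha lambda y * f y)%:E)%E.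
Proof.
move=> mf f0; apply/esym.
transitivity (\int[distribution P X]_y (f y)%:E)%E; last first.
  by rewrite ge0_integral_distribution//; exact/measurable_EFinP.
apply: (@ge0_integral_weighted _ _ _ _ R (@lebesgue_measure R)
  (distribution P X) id (gamma_pdf alpha lambda)) => //.
- exact: measurable_gamma_pdf.
- exact: gamma_pdf_ge0.
- move=> A mA; rewrite [RHS]X_gamma// /gamma_prob [RHS]integral_mkcond.
  apply: eq_integral => y _; rewrite patchE indicE.
  by case: ifPn; rewrite ?mulr1 ?mulr0.
Qed.

(** Nothing is computed: the law of [X] has total mass 1. This is what later shows that Gamma(alpha)
    converges and is positive. *)
Lemma integral_gamma_pdf :
  (\int[lebesgue_measure]_y (gamma_pdf alpha lambda y)%:E = 1)%E.
Proof.
transitivity (distribution P X setT); first by rewrite X_gamma.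
exact: probability_setT.
Qed.

Lemma integral_gamma_kernel_gamma_fun :
  0 < gamma_fun alpha /\
  (\int[lebesgue_measure]_y (gamma_kernel alpha 1 y)%:E =
   (gamma_fun alpha)%:E)%E.
Proof.
(* If the integral diverged, [gamma_fun alpha] would be 0 and the density of [X]
   would vanish. *)
have := integral_gamma_pdf.
under eq_integral do rewrite gamma_pdfE EFinM.
have [g0|g0] := eqVneq (gamma_fun alpha) 0.
  under eq_integral do rewrite g0 invr0 mulr0 mul0e.
  by rewrite integral0 => /eqP; rewrite eqe eq_sym oner_eq0.
move=> _; split; first by rewrite lt_neqAle eq_sym g0 gamma_fun_ge0.
rewrite gamma_funE fineK//.
have : (0 <= \int[lebesgue_measure]_y (gamma_kernel alpha 1 y)%:E)%E.
  by apply: integral_ge0 => y _; rewrite lee_fin gamma_kernel_ge0.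
by move: g0; rewrite gamma_funE; case: (\int[_]_y _)%E => //=; rewrite eqxx.
Qed.

(** The kernel times the density is a gamma kernel of shape alpha+a-1 and rate lambda+t. [m] stands
    for Gamma(alpha+a-1)/Gamma(alpha), supplied by the recurrence; the last factor is the Laplace
    transform of the gamma law. *)
Lemma expectation_gamma_kernel (a t m : R) : 0 <= t ->
  (\int[lebesgue_measure]_y (gamma_kernel (alpha + a - 1) 1 y)%:E =
   (m * gamma_fun alpha)%:E)%E ->
  (\int[P]_w (gamma_kernel a t (X w))%:E =
   (m * (lambda + t) `^ (1 - a) *
    (lambda `^ alpha * (lambda + t) `^ (- alpha)))%:E)%E.
Proof.
move=> t0 Gm; have [g0 _] := integral_gamma_kernel_gamma_fun.
have lt : 0 < lambda + t by rewrite ltr_wpDr.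
rewrite integral_gamma_variable; last 2 first.
- exact: measurable_gamma_kernel.
- by move=> y; exact: gamma_kernel_ge0.
under eq_integral do rewrite gamma_pdfE -mulrA gamma_kernelM EFinM.
rewrite ge0_integralZl_EFin ?divr_ge0 ?powR_ge0 ?gamma_fun_ge0//; last 2 first.
- by move=> y _; rewrite lee_fin gamma_kernel_ge0.
- by apply/measurable_EFinP; exact: measurable_gamma_kernel.
rewrite integral_gamma_kernel_scaling// Gm -!EFinM; congr EFin.
have -> : - (alpha + a - 1) = (1 - a) + - alpha by ring.
rewrite gt0_powRD//; field.
by rewrite gt_eqF.
Qed.

Lemma expectation_gamma_kernel1 (t : R) : 0 <= t ->
  (\int[P]_w (gamma_kernel 1 t (X w))%:E =
   (lambda `^ alpha * (lambda + t) `^ (- alpha))%:E)%E.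
Proof.
move=> t0; rewrite (expectation_gamma_kernel (m := 1))//.
  by rewrite subrr powRr0 !mul1r.
by rewrite addrK mul1r; have [] := integral_gamma_kernel_gamma_fun.
Qed.

(** At [t = 0] this yields the mean alpha/lambda. *)
Lemma expectation_gamma_kernel2 (t : R) : 0 <= t ->
  (\int[P]_w (gamma_kernel 2 t (X w))%:E =
   (alpha / (lambda + t) * (lambda `^ alpha * (lambda + t) `^ (- alpha)))%:E)%E.
Proof.
move=> t0; rewrite (expectation_gamma_kernel (m := alpha))//.
  have -> : 1 - 2 = -1 :> R by ring.
  by rewrite powR_inv1// addr_ge0// ltW.
have -> : alpha + 2 - 1 = alpha + 1 by ring.
apply: integral_gamma_kernelS => //.
by have [] := integral_gamma_kernel_gamma_fun.
Qed.

(** Two steps of the recurrence give alpha(alpha+1). This is the factor that carries the square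
    Y_i^2 in the ratio. *)
Lemma expectation_gamma_kernel3 (t : R) : 0 <= t ->
  (\int[P]_w (gamma_kernel 3 t (X w))%:E =
   (alpha * (alpha + 1) * (lambda + t) `^ (- 2) *
    (lambda `^ alpha * (lambda + t) `^ (- alpha)))%:E)%E.
Proof.
move=> t0; rewrite (expectation_gamma_kernel (m := alpha * (alpha + 1)))//.
  by have -> : 1 - 3 = -2 :> R by ring.
have -> : alpha + 3 - 1 = alpha + 1 + 1 by ring.
rewrite [alpha * _]mulrC -mulrA; apply: integral_gamma_kernelS.
  by rewrite addr_gt0.
apply: integral_gamma_kernelS => //.
by have [] := integral_gamma_kernel_gamma_fun.
Qed.

(** Allows the VMR to be replaced almost surely by expressions that agree with it on the positive
    orthant. *)
Lemma gamma_variable_gt0 : {ae P, forall w, 0 < X w}.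
Proof.
have mN : measurable [set y : R | y <= 0].
  have -> : [set y : R | y <= 0] = `]-oo, 0]%classic.
    by apply/seteqP; split => y /=; rewrite in_itv.
  exact: measurable_itv.
exists (X @^-1` [set y | y <= 0]); split.
- by rewrite -[X in measurable X]setTI; exact: measurable_funPT.
- rewrite -[LHS]/(distribution P X [set y | y <= 0]) X_gamma//.
  apply: integral0_eq => y /= y0.
  by rewrite gamma_pdfE gamma_kernel_le0// mulr0.
- by move=> w /= /negP; rewrite -leNgt.
Qed.

End gamma_variable.

(** * The ratio as a Laplace integral *)

(* Off the positive orthant the Laplace integral below vanishes because
   [gamma_kernel] does, whence the value 0. *)
Definition positive_square_ratio {R : realType} n (y : 'I_n -> R) (i : 'I_n) :
    R :=
  if [forall j, 0 < y j] then y i ^+ 2 / \sum_j y j else 0.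

Lemma positive_square_ratio_ge0 (R : realType) n (y : 'I_n -> R) i :
  0 <= positive_square_ratio y i.
Proof.
rewrite /positive_square_ratio; case: ifPn => // /forallP y0.
by rewrite divr_ge0 ?sqr_ge0// sumr_ge0// => j _; exact: ltW.
Qed.

(** The index [i] witnesses that the sum is nonempty. *)
Lemma sum_ord_gt0 (R : realType) n (y : 'I_n -> R) (i : 'I_n) :
  (forall j, 0 < y j) -> 0 < \sum_j y j.
Proof.
move=> y0; rewrite (bigD1 i)//= ltr_pwDl// sumr_ge0// => j _; exact: ltW.
Qed.

Lemma integral_prod_gamma_kernel (R : realType) n (y : 'I_n -> R) (i : 'I_n) :
  (\int[lebesgue_measure]_t (\1_`]0, +oo[ t *
     \prod_j gamma_kernel (if j == i then 3 else 1) t (y j))%:E =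
   (positive_square_ratio y i)%:E)%E.
Proof.
rewrite /positive_square_ratio; case: ifPn => [/forallP y0|]; last first.
  rewrite negb_forall => /existsP[j]; rewrite -leNgt => yj.
  apply: integral0_eq => t _.
  by rewrite (bigD1 j)//= gamma_kernel_le0// mul0r mulr0.
(* The factor exp(-tS), with S the sum of the y_j, is read as a kernel in the variable [t] with rate
   S, whose integral is 1/S. *)
transitivity (\int[lebesgue_measure]_t
    ((y i ^+ 2)%:E * (gamma_kernel 1 (\sum_j y j) t)%:E))%E.
  apply: eq_integral => t _; rewrite -EFinM; congr EFin.
  have -> : \prod_j gamma_kernel (if j == i then 3 else 1) t (y j) =
      y i ^+ 2 * \prod_j expR (- (t * y j)).
    rewrite !(bigD1 (P := predT) i)//= eqxx gamma_kernelE//.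
    have -> : 3 - 1 = 2%:R :> R by ring.
    rewrite powR_mulrn ?ltW// -[LHS]mulrA; congr (_ * (_ * _)).
    apply: eq_bigr => j /negbTE ->.
    by rewrite gamma_kernelE// subrr powRr0 mul1r.
  rewrite -expR_sum /gamma_kernel subrr powRr0 mul1r sumrN -mulr_sumr.
  by rewrite mulrCA [t * _]mulrC.
rewrite ge0_integralZl_EFin ?sqr_ge0//; last 2 first.
- by move=> t _; rewrite lee_fin gamma_kernel_ge0.
- by apply/measurable_EFinP; exact: measurable_gamma_kernel.
by rewrite integral_gamma_kernel1// sum_ord_gt0.
Qed.

Lemma sample_VMR_positive (R : realType) n (y : 'I_n -> R) :
  (0 < n)%N -> (forall j, 0 < y j) ->
  sample_VMR y = (n%:R - 1)^-1 *
    (n%:R * (\sum_i positive_square_ratio y i) - \sum_i gamma_kernel 2 0 (y i)).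
Proof.
move=> n0 y0; rewrite /sample_VMR; congr (_ * _).
have S0 := sum_ord_gt0 (Ordinal n0) y0.
have nR0 : n%:R != 0 :> R by rewrite pnatr_eq0 -lt0n.
have -> : \sum_i gamma_kernel 2 0 (y i) = \sum_i y i.
  apply: eq_bigr => i _; rewrite gamma_kernelE// mul0r oppr0 expR0 mulr1.
  have -> : 2 - 1 = 1 :> R by ring.
  by rewrite powRr1// ltW.
have -> : \sum_i positive_square_ratio y i = (\sum_i y i ^+ 2) / \sum_i y i.
  rewrite mulr_suml; apply: eq_bigr => i _.
  by rewrite /positive_square_ratio ifT//; apply/forallP.
(* Dividing this by the mean S/n turns the correction S^2/n into S. *)
have -> : \sum_(i < n) (y i - sample_mean y) ^+ 2 =
    \sum_i y i ^+ 2 - (\sum_i y i) ^+ 2 / n%:R.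
  under eq_bigr do rewrite sqrrB -mulr_natr -mulrA.
  rewrite big_split/= sumrB -mulr_suml sumr_const card_ord -mulr_natr.
  rewrite /sample_mean.
  by field.
rewrite /sample_mean; field.
by rewrite nR0 gt_eqF.
Qed.

(** * Expectation of the ratio for a gamma sample *)

Section gamma_sample.
Context {R : realType} d (T : measurableType d) (P : probability T R).
Variables (alpha lambda : R) (n : nat) (Y : 'I_n -> {RV P >-> R}).
Hypotheses (alpha_gt0 : 0 < alpha) (lambda_gt0 : 0 < lambda).
Hypothesis Y_indep : independent_RVs Y.
Hypothesis Y_gamma : forall (i : 'I_n) (A : set R), measurable A ->
  distribution P (Y i) A = gamma_prob alpha lambda A.

Let h i (z : T * R) : \bar R := (\1_`]0, +oo[ z.2 *
  \prod_j gamma_kernel (if j == i then 3 else 1) z.2 (Y j z.1))%:E.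

Let h_ge0 i z : (0 <= h i z)%E.
Proof.
rewrite lee_fin mulr_ge0// prodr_ge0// => j _; exact: gamma_kernel_ge0.
Qed.

Let measurable_h i : measurable_fun setT (h i).
Proof.
apply/measurable_EFinP/measurable_funM.
  exact: measurable_indic_pos.
apply: measurable_prod => j _; apply: measurable_gamma_kernel2 => //.
exact: measurableT_comp.
Qed.

(** The ratio is the partial integral over [t] of the jointly measurable [h], so Tonelli gives its
    measurability. *)
Lemma measurable_positive_square_ratio i :
  measurable_fun setT (fun w => positive_square_ratio (fun j => Y j w) i).
Proof.
apply/measurable_EFinP.
have := measurable_fun_fubini_tonelli_F (m2 := lebesgue_measure) (h i)
  (measurable_h i) (h_ge0 i).
congr measurable_fun; apply/funext => w.
by rewrite /fubini_F /h/= integral_prod_gamma_kernel.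
Qed.

Lemma expectation_positive_square_ratio i :
  (\int[P]_w (positive_square_ratio (fun j => Y j w) i)%:E =
   (alpha * (alpha + 1) / (lambda * (n%:R * alpha + 1)))%:E)%E.
Proof.
under eq_integral do rewrite -integral_prod_gamma_kernel.
rewrite (fubini_tonelli (m1 := P) (m2 := lebesgue_measure) (h i)
  (measurable_h i) (h_ge0 i))/=.
pose p : R := n%:R * alpha + 1.
have p0 : 0 < p by rewrite ltr_wpDl// mulr_ge0// ltW.
pose k : R := alpha * (alpha + 1) * lambda `^ (n%:R * alpha).
have k0 : 0 <= k by rewrite mulr_ge0 ?powR_ge0// mulr_ge0 ?addr_ge0// ltW.
(* At fixed [t > 0], independence gives [n] factors (lambda+t)^(-alpha) and one extra
   (lambda+t)^(-2): the exponent is -n alpha - 2 = -p - 1. *)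
transitivity (\int[lebesgue_measure]_t
    (k%:E * (\1_`]0, +oo[ t * (lambda + t) `^ (- p - 1))%:E))%E.
  apply: eq_integral => t _; rewrite /h/=.
  have [t0|t0] := leP t 0.
    rewrite indicE memNset ?mul0r ?mule0//=.
      by apply: integral0_eq => w _; rewrite mul0r.
    by rewrite in_itv/= andbT; apply/negP; rewrite -leNgt.
  rewrite indicE mem_set/= ?in_itv/= ?t0// mul1r.
  under eq_integral do rewrite mul1r.
  pose u : R := lambda `^ alpha * (lambda + t) `^ (- alpha).
  pose c j : R := (if j == i then alpha * (alpha + 1) * (lambda + t) `^ (- 2)
    else 1) * u.
  rewrite (integral_prod_independent (c := c)
    (g := fun j => gamma_kernel (if j == i then 3 else 1) t))//; last 3 first.
  - by move=> j; exact: measurable_gamma_kernel.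
  - by move=> j y; exact: gamma_kernel_ge0.
  - move=> j; rewrite /c; case: ifPn => _.
      by rewrite (expectation_gamma_kernel3 alpha_gt0 lambda_gt0 (Y_gamma j))
        ?ltW.
    by rewrite mul1r (expectation_gamma_kernel1 lambda_gt0 (Y_gamma j)) ?ltW.
  rewrite -EFinM; congr EFin.
  have lt0 : 0 < lambda + t by rewrite addr_gt0.
  rewrite big_split/= prodr_const card_ord -big_mkcond/= big_pred1_eq.
  rewrite /u exprMn -!powR_mulrn ?powR_ge0// -!powRrM /k /p.
  have -> : - (n%:R * alpha + 1) - 1 = - 2 + - alpha * n%:R by ring.
  rewrite (gt0_powRD _ _ lt0) [n%:R * alpha]mulrC; ring.
rewrite ge0_integralZl_EFin//; last 2 first.
- by move=> t _; rewrite lee_fin mulr_ge0 ?powR_ge0.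
- have mlt : measurable_fun [set: R] (fun t => lambda + t).
    exact: measurable_funD.
  apply/measurable_EFinP/measurable_funM; first exact: measurable_indic_pos.
  exact: (measurableT_comp (measurable_powR _) mlt).
rewrite integral_shifted_power// -EFinM; congr EFin.
have ln0 : lambda `^ (n%:R * alpha) != 0 by rewrite gt_eqF// powR_gt0.
(* The power lambda^(n alpha) in [k] cancels against lambda^(-p), leaving 1/lambda. *)
rewrite /k powRN /p gt0_powRD// powRr1 ?ltW//.
field.
by rewrite ln0 !gt_eqF.
Qed.

End gamma_sample.

(** * Measurability, integrability and the expectation of the VMR *)

(** Real powers are measurable, and x^(-1) = x (x^2)^(-1) has a nonnegative base; at 0 both sides
    are 0 since the inverse of 0 is 0. *)
Lemma measurable_inv (R : realType) :
  measurable_fun [set: R] (fun x : R => x^-1).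
Proof.
rewrite (_ : (fun x : R => x^-1) = fun x : R => x * (x ^+ 2) `^ (-1)).
  have msqr : measurable_fun [set: R] (fun x : R => x ^+ 2).
    exact: measurable_funX.
  apply: measurable_funM => //.
  exact: (measurableT_comp (measurable_powR _) msqr).
apply/funext => x; rewrite powR_inv1 ?sqr_ge0//.
have [->|x0] := eqVneq x 0; first by rewrite invr0 mul0r.
by field.
Qed.

Lemma measurable_sample_VMR (R : realType) d (T : measurableType d) n
    (Y : 'I_n -> T -> R) :
  (forall i, measurable_fun setT (Y i)) ->
  measurable_fun setT (fun w => sample_VMR (fun i => Y i w)).
Proof.
move=> mY.
have mm : measurable_fun setT (fun w => sample_mean (fun i => Y i w)).
  by apply: measurable_funM => //; exact: measurable_sum.
apply: measurable_funM => //; apply: measurable_funM.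
  apply: measurable_sum => i; apply: measurable_funX.
  exact: measurable_funB.
exact: (measurableT_comp (@measurable_inv R) mm).
Qed.

(** Integrability comes with the value because two such sums will be subtracted. *)
Lemma integral_sum_const (R : realType) d (T : measurableType d)
    (mu : {measure set T -> \bar R}) n (f : 'I_n -> T -> R) (c : R) :
  (forall i, measurable_fun setT (f i)) -> (forall i x, 0 <= f i x) ->
  (forall i, (\int[mu]_x (f i x)%:E = c%:E)%E) ->
  (\int[mu]_x (\sum_i f i x)%:E = (n%:R * c)%:E)%E /\
  mu.-integrable setT (fun x => (\sum_i f i x)%:E).
Proof.
move=> mf f0 fc.
have sumE : (\int[mu]_x (\sum_i f i x)%:E = (n%:R * c)%:E)%E.
  under eq_integral do rewrite -sumEFin.
  rewrite ge0_integral_sum//; last 2 first.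
  - by move=> i; exact/measurable_EFinP.
  - by move=> i x _; rewrite lee_fin.
  rewrite (eq_bigr (fun=> c%:E))// sumEFin sumr_const card_ord.
  by rewrite mulr_natl.
split=> //; apply/integrableP; split.
  by apply/measurable_EFinP; exact: measurable_sum.
under eq_integral do rewrite gee0_abs ?lee_fin ?sumr_ge0//.
by rewrite sumE ltry.
Qed.

Theorem theorem5 (R : realType) (d : measure_display) (T : measurableType d)
    (P : probability T R) (alpha lambda : R) (n : nat)
    (Y : 'I_n -> {RV P >-> R})
    (alpha_gt0 : 0 < alpha) (lambda_gt0 : 0 < lambda) (n_ge2 : (2 <= n)%N)
    (Y_indep : independent_RVs Y)
    (Y_gamma : forall (i : 'I_n) (A : set R), measurable A ->
       distribution P (Y i) A = gamma_prob alpha lambda A) :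
  ('E_P[fun w => sample_VMR (fun i => Y i w)]
   = (n%:R * alpha / ((n%:R * alpha + 1) * lambda))%:E)%E.
Proof.
rewrite unlock.
have [A_E A_int] := integral_sum_const
  (measurable_positive_square_ratio Y)
  (fun i w => positive_square_ratio_ge0 (fun j => Y j w) i)
  (expectation_positive_square_ratio alpha_gt0 lambda_gt0 Y_indep Y_gamma).
have VE i : (\int[P]_w (gamma_kernel 2 0 (Y i w))%:E = (alpha / lambda)%:E)%E.
  rewrite (expectation_gamma_kernel2 alpha_gt0 lambda_gt0 (Y_gamma i))//.
  by rewrite addr0 -gt0_powRD// subrr powRr0 mulr1.
have mV i : measurable_fun setT (fun w => gamma_kernel 2 0 (Y i w)).
  exact: measurable_gamma_kernel2.
have [B_E B_int] :=
  integral_sum_const mV (fun i w => gamma_kernel_ge0 _ _ _) VE.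
have n0 : (0 < n)%N by exact: leq_trans n_ge2.
pose A w := \sum_i positive_square_ratio (fun j => Y j w) i.
pose B w := \sum_i gamma_kernel 2 0 (Y i w).
have nA_int : P.-integrable setT (fun w => n%:R%:E * (A w)%:E)%E.
  exact: integrableZl.
(* The two integrands agree where all [Y i] are positive, an almost sure event. *)
transitivity (\int[P]_w ((n%:R - 1)^-1%:E * (n%:R%:E * (A w)%:E - (B w)%:E)))%E.
  apply: ae_eq_integral => //.
  - by apply/measurable_EFinP; exact: measurable_sample_VMR.
  - apply: measurable_funeM; apply: emeasurable_funB.
      exact: measurable_int nA_int.
    exact: measurable_int B_int.
  - have : \forall w \near almost_everywhere P, forall i, 0 < Y i w.
      by apply: filter_forall => i; exact: (gamma_variable_gt0 (Y_gamma i)).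
    apply: filterS => w Yw _.
    by rewrite sample_VMR_positive.
rewrite integralZl//; last exact: integrableB.
rewrite integralB//.
rewrite integralZl// A_E B_E; apply: (congr1 EFin).
(* The algebra rests on n(alpha+1) - (n alpha+1) = n-1, which cancels the normalisation, nonzero as
   [n] is at least 2. *)
have n1 : n%:R - 1 != 0 :> R by rewrite subr_eq0 pnatr_eq1 gtn_eqF.
have p0 : n%:R * alpha + 1 != 0 by rewrite gt_eqF// ltr_wpDl// mulr_ge0// ltW.
by field; rewrite n1 p0 gt_eqF.
Qed.
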